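(* Let $(\Omega,\mathcal F,\mathbb P)$ be a nonatomic probability space, $u:\mathbb R\to\mathbb R$ a utility function, and $\alpha\in\mathbb R$ a level such that $\alpha\le u(x)$ for some $x\in\mathbb R$. Consider a traded asset $S=(S_0,S_T)$ with $S_T\in H^{\widehat u}$. (i) If $u$ is bounded from above, the following statements are equivalent: (a) $\rho_{\mathcal A_u,S}$ is finitely valued; (b) $u(x_0)>\alpha$ for some $x_0>0$ and $\mathbb P(S_T=0)=0$. In this case, $\rho_{\mathcal A_u,S}$ is continuous. (ii) If $u$ is not bounded from above, then $\rho_{\mathcal A_u,S}$ is always finitely valued and continuous.
   Context: A utility function is a nonconstant, concave, increasing (i.e. nondecreasing) function $u:\mathbb R\to\mathbb R$. Put $\widehat u(x)=u(0)-u(-|x|)$, which is an Orlicz function. The Orlicz heart is $H^{\widehat u}=\{X\in L^0 : \mathbb E[\widehat u(\lambda X)]<\infty \text{ for every }\lambda>0\}$, equipped with the Luxemburg norm $\|X\|_{\widehat u}=\inf\{\lambda>0 : \mathbb E[\widehat u(X/\lambda)]\le1\}$ and the almost sure order (random variables equal almost surely are identified). A traded asset is a pair $S=(S_0,S_T)$ with $S_0>0$ real and $S_T\in H^{\widehat u}$ nonzero with $S_T\ge0$ a.s. Set $\mathcal A_u=\{X\in H^{\widehat u} : \mathbb E[u(X)]\ge\alpha\}$ and define the shortfall risk measure $\rho_{\mathcal A_u,S}:H^{\widehat u}\to\mathbb R\cup\{\pm\infty\}$ by $$\rho_{\mathcal A_u,S}(X)=\inf\{m\in\mathbb R : \mathbb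 E[u(X+\tfrac{m}{S_0}S_T)]\ge\alpha\},\qquad \inf\emptyset=\infty.$$ Continuity is with respect to the Luxemburg norm. *)

(* Defs.v *)
From mathcomp Require Import all_boot all_order all_algebra.
From mathcomp Require Import all_classical all_reals all_analysis.
Set Implicit Arguments.
Unset Strict Implicit.
Unset Printing Implicit Defensive.
Import Order.TTheory GRing.Theory Num.Theory.
Import numFieldNormedType.Exports.
Local Open Scope classical_set_scope.
Local Open Scope ring_scope.

Definition nonatomic d (T : measurableType d) (R : realType)
    (P : probability T R) : Prop :=
  forall A : set T, measurable A -> (0 < P A)%E ->
  exists B : set T, [/\ measurable B, B `<=` A, (0 < P B)%E & (P B < P A)%E].

Definition utility_function (R : realType) (u : R -> R) : Prop :=
  [/\ ~ (exists c : R, forall x, u x = c),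
      convex_function (setT : set R) (fun x => - u x)
    & {homo u : x y / x <= y}].

Definition orlicz_of_utility (R : realType) (u : R -> R) : R -> R :=
  fun x => u 0 - u (- `|x|).

(* L0 is {mfun_ P, T >-> R}: measurable functions modulo P-a.s. equality. Its
   elements coerce to functions through a chosen representative, on which the
   notions below do not depend. *)
Section orlicz.
Context d (T : measurableType d) (R : realType).
Variables (P : probability T R) (phi : R -> R).

Definition orlicz_heart : set {mfun_ P, T >-> R} :=
  [set X : {mfun_ P, T >-> R} |
    forall l : R, 0 < l -> ('E_P[fun w => phi (l * X w)%R] < +oo)%E].

(* Stated for plain functions so that it applies to differences of elements
   of L0, for which the library provides no operations. On the Orlicz heart the
   set is nonempty and bounded below, so that inf is the genuine infimum. *)
Definition luxemburg_norm (X : T -> R) : R :=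
  inf [set l : R | 0 < l /\ ('E_P[fun w => phi (X w / l)%R] <= 1)%E].

Definition luxemburg_nbhs (X : {mfun_ P, T >-> R}) :
    set_system {mfun_ P, T >-> R} :=
  filter_from [set e : R | 0 < e]
    (fun e => [set Y | orlicz_heart Y /\
                       luxemburg_norm (fun w => Y w - X w) < e]).

Definition finitely_valued (rho : {mfun_ P, T >-> R} -> \bar R) : Prop :=
  forall X, orlicz_heart X -> rho X \is a fin_num.

Definition luxemburg_continuous (rho : {mfun_ P, T >-> R} -> \bar R) : Prop :=
  forall X, orlicz_heart X -> rho @ luxemburg_nbhs X --> rho X.

Definition traded_asset (S0 : R) (ST : {mfun_ P, T >-> R}) : Prop :=
  [/\ 0 < S0, orlicz_heart ST, ~ {ae P, forall w, ST w = 0}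
    & {ae P, forall w, 0 <= ST w}].

End orlicz.

Definition shortfall_risk d (T : measurableType d) (R : realType)
    (P : probability T R) (u : R -> R) (alpha S0 : R)
    (ST X : {mfun_ P, T >-> R}) : \bar R :=
  ereal_inf [set m%:E | m in
    [set m : R | (alpha%:E <= 'E_P[fun w => u (X w + m / S0 * ST w)%R])%E]].

(* Main.v *)
Require Import Defs.
From mathcomp Require Import all_boot all_order all_algebra.
From mathcomp Require Import all_classical all_reals all_analysis.
From mathcomp Require Import measurable_realfun ring lra.
Import Order.TTheory GRing.Theory Num.Theory.
Import numFieldNormedType.Exports.
Local Open Scope classical_set_scope.
Local Open Scope ring_scope.

(** Write [S] for the payoff, [phi] for the Orlicz function of [u] and
   [f_X(m) = E[u(X + m S / S0)]], which is concave and nondecreasing in [m].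
   Since [u] lies below an affine function of positive slope and [E[S] > 0],
   [f_X] tends to [-oo] at [-oo]; so the risk of [X] is finite, and
   [m > rho(X)] implies [f_X(m) > alpha], as soon as [f_X] exceeds [alpha]
   somewhere. By dominated convergence it does when [u] is unbounded ([S > 0]
   has positive probability), or when [u(x0) > alpha] and [S > 0] a.s.
   Continuity reduces to that of [X |-> E[u(X)]], which follows from writing
   [W + Z] as the convex combination [(1 - e) W + e (W + Z / e)], and [W] as one
   of [W + Z] and [W - Z / e].

   Conversely, if [S = 0] on a nonnull set, a large negative constant has risk
   [+oo]. If [u <= alpha], an acceptable position satisfies [u = alpha] a.s., so
   a position of the Orlicz heart that is unbounded below on a nonnull set where
   [S] is bounded has risk [+oo]; such a position exists by nonatomicity. *)

(** * Utility functions and their Orlicz functions *)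

Section utility.
Context {R : realType} {u : R -> R}.
Hypothesis uu : utility_function u.

Local Notation phi := (orlicz_of_utility u).

Lemma utility_homo : {homo u : x y / x <= y}.
Proof. by case: uu. Qed.

Lemma utility_concave (t x y : R) : 0 <= t -> t <= 1 ->
  (1 - t) * u x + t * u y <= u ((1 - t) * x + t * y).
Proof.
move=> t0 t1; case: uu => _ cvx _.
have t01 : Itv.spec (@Itv.num_sem R) (Itv.Real `[0%Z, 1%Z]) t.
  by rewrite /= /Itv.num_sem /= realE t0 in_itv /= t0 t1.
have := cvx (Itv.mk t01) y x; rewrite !inE => /(_ I I).
move=> h.
have {h} : - u (t * y + (1 - t) * x) <= t * - u y + (1 - t) * - u x := h.
by rewrite addrC; lra.
Qed.

(** The slope is that of a secant through [x < y] with [u x < u y]. By concavity [u] lies below this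
    secant outside [[x, y]]; the line is raised by [u y - u x] so that [u z <= u y] suffices in
    between. *)
Lemma utility_le_affine : exists s c : R, 0 < s /\ forall z, u z <= c + s * z.
Proof.
have [x [y [xy uxy]]] : exists x y : R, x < y /\ u x < u y.
  apply: contrapT => nex; case: uu => nc _ _; apply: nc; exists (u 0) => x.
  have [x0|x0|-> //] := ltgtP x 0.
  - have [h|h] := leP (u 0) (u x); last by case: nex; exists x, 0.
    by apply/eqP; rewrite eq_le h utility_homo ?ltW.
  - have [h|h] := leP (u x) (u 0); last by case: nex; exists 0, x.
    by apply/eqP; rewrite eq_le h utility_homo ?ltW.
have yx0 : 0 < y - x by rewrite subr_gt0.
pose s := (u y - u x) / (y - x).
have s0 : 0 < s by rewrite divr_gt0// subr_gt0.
have sE : s * (y - x) = u y - u x by rewrite divfK// gt_eqF.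
exists s, (u y - s * x); split=> // z.
suff : u z - u y <= s * (z - x) by lra.
have [zx|zx] := leP z x.
- have yz : 0 < y - z by lra.
  pose t := (x - z) / (y - z).
  have tE : t * (y - z) = x - z by rewrite divfK//; lra.
  have t0 : 0 <= t by rewrite divr_ge0//; lra.
  have t1 : t < 1 by rewrite ltr_pdivrMr//; lra.
  have := utility_concave t z y t0 (ltW t1).
  have -> : (1 - t) * z + t * y = x by lra.
  by nra.
- have [zy|zy] := leP z y.
    have := utility_homo _ _ zy; have : 0 <= s * (z - x) by nra.
    lra.
  have xz : 0 < z - x by lra.
  pose t := (y - x) / (z - x).
  have tE : t * (z - x) = y - x by rewrite divfK//; lra.
  have t0 : 0 < t by rewrite divr_gt0.
  have t1 : t <= 1 by rewrite ler_pdivrMr//; lra.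
  have := utility_concave t x z (ltW t0) t1.
  have -> : (1 - t) * x + t * z = y by lra.
  by nra.
Qed.

Lemma orlicz_ge0 x : 0 <= phi x.
Proof. by rewrite subr_ge0 utility_homo// oppr_le0. Qed.

Lemma orlicz_homo x y : `|x| <= `|y| -> phi x <= phi y.
Proof. by move=> xy; rewrite lerD2l lerN2 utility_homo// lerN2. Qed.

Lemma orliczN x : phi (- x) = phi x.
Proof. by rewrite /orlicz_of_utility normrN. Qed.

(** [|x + y|] is at most twice the larger of [|x|] and [|y|]; the other term is only nonnegative.
    The factor [2] is harmless on the Orlicz heart. *)
Lemma orliczD x y : phi (x + y) <= phi (2 * x) + phi (2 * y).
Proof.
have [xy|yx] := leP `|x| `|y|.
- apply: le_trans (ler_wpDl (orlicz_ge0 _) (lexx _)).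
  by apply: orlicz_homo; rewrite normrM ger0_norm//; have := ler_normD x y; lra.
- apply: le_trans (ler_wpDr (orlicz_ge0 _) (lexx _)).
  by apply: orlicz_homo; rewrite normrM ger0_norm//; have := ler_normD x y; lra.
Qed.

Lemma utility_ge_orlicz x : u 0 - phi x <= u x.
Proof.
by rewrite /orlicz_of_utility opprB addrCA subrr addr0 utility_homo// lerNl -normrN ler_norm.
Qed.

(** The affine bound at [- |x|] controls [|x|] by [phi x]; then [u x] lies between [u 0 - phi x] and
    its affine bound. Hence integrability of [phi (X)] passes to [X] and [u (X)]. *)
Lemma norm_le_orlicz : exists c : R, forall x, `|x| <= c * (phi x + c) /\
  `|u x| <= c * (phi x + c).
Proof.
have [s [c [s0 uc]]] := utility_le_affine.
have si : s * s^-1 = 1 by rewrite mulfV ?gt_eqF.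
have si0 : 0 < s^-1 by rewrite invr_gt0.
exists (2 + s^-1 + `|c| + `|u 0|) => x.
have phi0 := orlicz_ge0 x.
have c0 := normr_ge0 c; have u0 := normr_ge0 (u 0).
have cc := ler_norm c; have cN := ler_norm (- c); rewrite normrN in cN.
have uu0 := ler_norm (u 0); have uN := ler_norm (- u 0); rewrite normrN in uN.
have h1 : s * `|x| <= phi x + `|c| + `|u 0|.
  by have := uc (- `|x|); rewrite /orlicz_of_utility; lra.
have h2 : `|x| <= s^-1 * (phi x + `|c| + `|u 0|).
  by rewrite mulrC ler_pdivlMr// mulrC.
split; first by nra.
have h3 := utility_ge_orlicz x.
have h4 : u x <= phi x + 2 * `|c| + `|u 0|.
  by have := uc x; have := ler_norm x; nra.
rewrite ler_norml; apply/andP; split; nra.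
Qed.

Lemma measurable_utility : measurable_fun setT u.
Proof. by apply: measurable_realfun.nondecreasing_measurable => // x y; exact: utility_homo. Qed.

Lemma measurable_orlicz : measurable_fun setT phi.
Proof.
apply: measurable_funB => //; apply: measurableT_comp; first exact: measurable_utility.
by apply: measurableT_comp => //; exact: measurable_normr.
Qed.


(** Concavity of [u] between [0] and [- |x|]: [phi] is convex and vanishes at [0]. *)
Lemma orlicz_div (l x : R) : 1 <= l -> phi (x / l) <= phi x / l.
Proof.
move=> l1; have l0 : 0 < l by lra.
have := utility_concave l^-1 0 (- `|x|).
rewrite invr_ge0 invf_le1// ltW// l1 => /(_ isT isT).
rewrite mulr0 add0r /orlicz_of_utility normrM normfV (gtr0_norm l0).
by rewrite mulrN [l^-1 * `|x|]mulrC; lra.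
Qed.

(** The auxiliary points [w + z / e] and [w - z / e], with weight [e = 2 * l], have utility at least
    [u 0 - phi (2 * w) - phi (2 * (z / e))]. The factor [2] in [e] turns the last argument into
    [z / l], the one in the Luxemburg norm. *)
Lemma utility_perturb (l w z : R) : 0 < l -> 2 * l <= 1 ->
  (1 - 2 * l) * u w + 2 * l * (u 0 - phi (2 * w) - phi (z / l)) <= u (w + z) /\
  u (w + z) + 2 * l * (u 0 - phi (2 * w) - phi (z / l)) <= (1 + 2 * l) * u w.
Proof.
move=> l0 l1; set e := 2 * l; have e0 : 0 < e by rewrite /e; lra.
have eE : e * (z / e) = z by rewrite mulrC divfK ?gt_eqF.
have leE : 2 * (z / e) = z / l by rewrite /e; field; rewrite gt_eqF.
have en0 : e != 0 by rewrite gt_eqF.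
have e1n0 : 1 + e != 0 by rewrite gt_eqF//; lra.
split.
- have := utility_concave e w (w + z / e) (ltW e0) l1.
  have -> : (1 - e) * w + e * (w + z / e) = w + z by rewrite mulrDr eE; lra.
  have := utility_ge_orlicz (w + z / e).
  have := orliczD w (z / e); rewrite leE => h1 h2.
  have : e * (u 0 - phi (2 * w) - phi (z / l)) <= e * u (w + z / e).
    by apply: ler_wpM2l; [exact: ltW | lra].
  lra.
(* With this weight on [w - z / e] and [1 / (1 + e)] on [w + z], the combination is [w]; the
   inequality is then multiplied by [1 + e]. *)
- pose t := e / (1 + e).
  have tE : t * (1 + e) = e by rewrite divfK//; lra.
  have t0 : 0 <= t by rewrite divr_ge0//; lra.
  have t1 : t <= 1 by rewrite ler_pdivrMr//; lra.
  have := utility_concave t (w + z) (w - z / e) t0 t1.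
  have -> : (1 - t) * (w + z) + t * (w - z / e) = w by rewrite /t; field; rewrite ?en0 e1n0.
  have e1 : 0 <= 1 + e by lra.
  move=> /(ler_wpM2l e1).
  have -> : (1 + e) * ((1 - t) * u (w + z) + t * u (w - z / e)) =
    u (w + z) + e * u (w - z / e) by rewrite /t; field; rewrite ?en0 e1n0.
  have := utility_ge_orlicz (w - z / e).
  have := orliczD w (- (z / e)); rewrite mulrN orliczN leE => h1 h2.
  have : e * (u 0 - phi (2 * w) - phi (z / l)) <= e * u (w - z / e).
    by apply: ler_wpM2l; [exact: ltW | lra].
  lra.
Qed.

End utility.

(** * Integration on the Orlicz heart *)

Section real_integral.
Context {d : measure_display} {T : measurableType d} {R : realType}.
Context {P : probability T R}.
Implicit Types f g : T -> R.

Local Notation integrable f := (P.-integrable setT (EFin \o f)).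

Lemma integrable_measurable f : integrable f -> measurable_fun setT f.
Proof. by move=> /(measurable_int P)/measurable_EFinP. Qed.

Lemma integrable_dominated f g : measurable_fun setT f ->
  (forall w, `|f w| <= g w) -> integrable g -> integrable f.
Proof.
move=> mf fg; apply: le_integrable => //; first exact/measurable_EFinP.
by move=> w _ /=; rewrite lee_fin (le_trans (fg w))// ler_norm.
Qed.

Lemma integrable_add f g : integrable f -> integrable g ->
  integrable (fun w => f w + g w).
Proof. by move=> fi gi; exact: (integrableD _ fi gi). Qed.

Lemma integrable_scale c f : integrable f -> integrable (fun w => c * f w).
Proof. by move=> fi; exact: (integrableZl _ c fi). Qed.

Lemma integrable_cst c : integrable (fun=> c).
Proof. exact: finite_measure_integrable_cst. Qed.

Lemma Rintegral_prob_cst c : \int[P]_w c = c.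
Proof. by rewrite Rintegral_cst//= (@probability_setT _ _ _ P) mulr1. Qed.

Lemma ae_eq_integrable f g : integrable f -> measurable_fun setT g ->
  {ae P, forall w, f w = g w} -> integrable g.
Proof.
move=> fi mg [N [mN N0 Nfg]].
have mE (h : T -> R) : measurable_fun setT h -> measurable_fun setT (EFin \o h).
  by move=> ?; exact/measurable_EFinP.
apply/(negligible_integrable mN measurableT (mE _ mg) N0).
have /(negligible_integrable mN measurableT (mE _ (integrable_measurable _ fi)) N0) := fi.
apply: eq_integrable; first exact: measurableD.
move=> w; rewrite inE => -[_ Nw] /=; congr EFin.
by apply: contrapT => fgw; exact/Nw/Nfg.
Qed.

Lemma ae_eq_Rintegral f g : measurable_fun setT f -> measurable_fun setT g ->
  {ae P, forall w, f w = g w} -> \int[P]_w f w = \int[P]_w g w.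
Proof.
move=> mf mg fg; congr fine; apply: ae_eq_integral => //.
- exact/measurable_EFinP.
- exact/measurable_EFinP.
- by apply: filterS fg => w /= -> _.
Qed.

(** The passage from extended expectations, in which the risk is defined, to the real integrals used
    throughout. *)
Lemma EFin_Rintegral f : P.-integrable setT (EFin \o f) ->
  'E_P[f]%E = (\int[P]_w f w)%:E.
Proof. by move=> fi; rewrite unlock /Rintegral fineK// integrable_fin_num. Qed.

Lemma Rintegral_eq0 (f : T -> R) : P.-integrable setT (EFin \o f) ->
  (forall w, 0 <= f w) -> \int[P]_w f w = 0 -> {ae P, forall w, f w = 0}.
Proof.
move=> fi f0 f0E.
have : (\int[P]_w `|(f w)%:E| = 0)%E.
  under eq_integral do rewrite gee0_abs ?lee_fin//.
  by have := EFin_Rintegral _ fi; rewrite f0E unlock.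
have mf : measurable_fun setT (EFin \o f) by exact: (measurable_int P fi).
move/(ae_eq_integral_abs _ measurableT mf).
by apply: filterS => w /(_ I) [].
Qed.

End real_integral.

(** * Stability of the Orlicz heart and perturbation of expected utility *)

Section heart.
Context {d : measure_display} {T : measurableType d} {R : realType}.
Context {P : probability T R} {u : R -> R}.
Hypothesis uu : utility_function u.
Implicit Types f g : T -> R.

Local Notation phi := (orlicz_of_utility u).
Local Notation integrable f := (P.-integrable setT (EFin \o f)).

(** Membership in the heart for functions rather than classes, so that positions can be added
    pointwise; [orlicz_heartP] relates the two. *)
Definition heart_fun f : Prop := measurable_fun setT f /\
  forall l : R, 0 < l -> integrable (fun w => phi (l * f w)).

Lemma heart_measurable f : heart_fun f -> measurable_fun setT f.
Proof. by case. Qed.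

Lemma measurable_orlicz_comp f : measurable_fun setT f ->
  measurable_fun setT (fun w => phi (f w)).
Proof. by move=> mf; apply: measurableT_comp mf; exact: measurable_orlicz. Qed.

Lemma measurable_utility_comp f : measurable_fun setT f ->
  measurable_fun setT (fun w => u (f w)).
Proof. by move=> mf; apply: measurableT_comp mf; exact: measurable_utility. Qed.

Lemma measurable_scale (c : R) f : measurable_fun setT f ->
  measurable_fun setT (fun w => c * f w).
Proof. by move=> mf; apply: measurable_funM. Qed.

Lemma heart_domM (c : R) f g : measurable_fun setT g ->
  (forall w, `|g w| <= c * `|f w|) -> heart_fun f -> heart_fun g.
Proof.
move=> mg gf [mf fi]; split=> // l l0.
(* The [+ 1] keeps the factor positive when [c = 0], as integrability is given for positive
   multiples only. *)
have cl : 0 < l * (`|c| + 1) by rewrite mulr_gt0// ltr_wpDl.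
apply: integrable_dominated (fi _ cl).
  exact/measurable_orlicz_comp/measurable_scale.
move=> w; rewrite ger0_norm ?(orlicz_ge0 uu)//; apply: (orlicz_homo uu).
rewrite !normrM -mulrA ler_wpM2l// (le_trans (gf w))//.
by rewrite ler_wpM2r// (le_trans (ler_norm c))// ger0_norm ?lerDl// addr_ge0.
Qed.

Lemma heartM (c : R) f : heart_fun f -> heart_fun (fun w => c * f w).
Proof.
move=> hf; apply: (heart_domM `|c| f) => //; last by move=> w; rewrite normrM.
exact/measurable_scale/heart_measurable.
Qed.

Lemma heartD f g : heart_fun f -> heart_fun g ->
  heart_fun (fun w => f w + g w).
Proof.
move=> [mf fi] [mg gi]; split=> [|l l0]; first exact: measurable_funD.
have l20 : 0 < 2 * l by rewrite mulr_gt0.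
apply: integrable_dominated (integrable_add _ _ (fi _ l20) (gi _ l20)).
  exact/measurable_orlicz_comp/measurable_scale/measurable_funD.
move=> w; rewrite ger0_norm ?(orlicz_ge0 uu)// mulrDr -!mulrA.
exact: (orliczD uu).
Qed.

Lemma heart_integrable f : heart_fun f ->
  integrable f /\ integrable (fun w => u (f w)).
Proof.
move=> [mf fi]; have [c hc] := norm_le_orlicz uu.
have ci : integrable (fun w => c * (phi (f w) + c)).
  apply/integrable_scale/integrable_add; last exact: integrable_cst.
  by have := fi 1 ltr01; under eq_fun do rewrite mul1r.
split; apply: integrable_dominated ci => //.
- by move=> w; have [] := hc (f w).
- exact: measurable_utility_comp.
- by move=> w; have [] := hc (f w).
Qed.

Lemma heart_cst (c : R) : heart_fun (fun=> c).
Proof. by split=> // l _; exact: integrable_cst. Qed.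

Lemma ae_eq_heart f g : heart_fun f -> measurable_fun setT g ->
  {ae P, forall w, f w = g w} -> heart_fun g.
Proof.
move=> [mf fi] mg fg; split=> // l /fi fli; apply: ae_eq_integrable fli _ _.
  exact/measurable_orlicz_comp/measurable_scale.
by apply: filterS fg => w /= ->.
Qed.

(** Integrating both halves of [utility_perturb]. The bracket depends on [f] alone, so the
    difference vanishes with [l], uniformly in the admissible [g]. *)
Lemma heart_perturb (l : R) f g : heart_fun f -> heart_fun g ->
  0 < l -> 2 * l <= 1 -> \int[P]_w phi (g w / l) <= 1 ->
  `|\int[P]_w u (f w + g w) - \int[P]_w u (f w)| <=
  2 * l * (\int[P]_w u (f w) - u 0 + \int[P]_w phi (2 * f w) + 1).
Proof.
move=> hf hg l0 l1 gl.
have [_ ui] := heart_integrable _ hf.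
have [_ udi] := heart_integrable _ (heartD _ _ hf hg).
have [_ f2i] := hf; have {}f2i := f2i 2 ltac:(by []).
have gi : integrable (fun w => phi (g w / l)).
  have [_ /(_ l^-1)] := hg; rewrite invr_gt0 => /(_ l0).
  by under eq_fun do rewrite mulrC.
(* The common lower bound for the utility at the two auxiliary points. *)
pose k w := u 0 + (-1 * phi (2 * f w) + -1 * phi (g w / l)).
have ki : integrable k.
  apply: integrable_add; first exact: integrable_cst.
  by apply: integrable_add; exact: integrable_scale.
have kE : \int[P]_w k w =
    u 0 - \int[P]_w phi (2 * f w) - \int[P]_w phi (g w / l).
  rewrite RintegralD//; [|exact: integrable_cst|
    by apply: integrable_add; exact: integrable_scale].
  rewrite RintegralD//; [|exact: integrable_scale..].
  by rewrite !RintegralZl// Rintegral_prob_cst !mulN1r addrA.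
have lo : (1 - 2 * l) * \int[P]_w u (f w) + 2 * l * \int[P]_w k w <=
    \int[P]_w u (f w + g w).
  rewrite -!RintegralZl// -RintegralD//; [|exact: integrable_scale..].
  apply: le_Rintegral => //.
    by apply: integrable_add; exact: integrable_scale.
  move=> w _; have [+ _] := utility_perturb uu l (f w) (g w) l0 l1.
  by rewrite /k !mulN1r addrA.
have hi : \int[P]_w u (f w + g w) + 2 * l * \int[P]_w k w <=
    (1 + 2 * l) * \int[P]_w u (f w).
  rewrite -!RintegralZl// -RintegralD//; [|exact: integrable_scale].
  apply: le_Rintegral => //; [|exact: integrable_scale|].
    by apply: integrable_add => //; exact: integrable_scale.
  move=> w _; have [_ +] := utility_perturb uu l (f w) (g w) l0 l1.
  by rewrite /k !mulN1r addrA.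
have {gl kE} : 2 * l * (u 0 - \int[P]_w phi (2 * f w) - 1) <=
    2 * l * \int[P]_w k w.
  by apply: ler_wpM2l; lra.
by rewrite ler_norml => kl; apply/andP; split; lra.
Qed.

End heart.

(** * Acceptability levels and the shortfall risk *)

Section luxemburg.
Context {d : measure_display} {T : measurableType d} {R : realType}.
Context {P : probability T R} {u : R -> R}.
Hypothesis uu : utility_function u.
Implicit Types f g : T -> R.

Local Notation phi := (orlicz_of_utility u).

(** An element of the defining set close to its infimum; this needs the set to be nonempty, since
    the infimum of an empty set would be a default value. *)
Lemma luxemburg_norm_lt (e : R) f : heart_fun (P := P) (u := u) f ->
  luxemburg_norm P phi f < e ->
  exists l : R, [/\ 0 < l, l < e & \int[P]_w phi (f w / l) <= 1].
Proof.
move=> hf; rewrite /luxemburg_norm; set A := [set l | _] => fe.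
have AP l : 0 < l -> A l <-> \int[P]_w phi (f w / l) <= 1.
  move=> l0; rewrite /A /= EFin_Rintegral ?lee_fin; first by split=> // -[].
  have [_ /(_ l^-1)] := hf; rewrite invr_gt0 => /(_ l0).
  by under eq_fun do rewrite mulrC.
have fi : P.-integrable setT (EFin \o (fun w => phi (f w))).
  by have [_ /(_ 1 ltr01)] := hf; under eq_fun do rewrite mul1r.
have phi0 : 0 <= \int[P]_w phi (f w).
  by apply: Rintegral_ge0 => w _; exact: orlicz_ge0.
have infA : has_inf A.
  split; last by exists 0 => l [/ltW].
  (* By [orlicz_div] the integral of [phi (f / l)] is at most that of [phi (f)] divided by [l],
     which is at most [1] for this [l]. *)
  pose l := 1 + \int[P]_w phi (f w).
  have l1 : 1 <= l by rewrite lerDl.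
  have l0 : 0 < l by lra.
  exists l; apply/AP => //.
  apply: (@le_trans _ _ (\int[P]_w (l^-1 * phi (f w)))).
    apply: le_Rintegral => //; [|exact: integrable_scale|].
      have [_ /(_ l^-1)] := hf; rewrite invr_gt0 => /(_ l0).
      by under eq_fun do rewrite mulrC.
    by move=> w _; rewrite [leRHS]mulrC (orlicz_div uu).
  by rewrite RintegralZl// mulrC ler_pdivrMr// mul1r lerDr.
have := inf_adherent (_ : 0 < e - inf A) infA.
rewrite subr_gt0 => /(_ fe)[l Al]; rewrite addrC subrK => le.
have l0 : 0 < l by case: Al.
by exists l; split=> //; apply/AP.
Qed.

End luxemburg.

(** * Expected utility along the asset and its acceptability threshold *)

Section level.
Context {d : measure_display} {T : measurableType d} {R : realType}.
Context {P : probability T R} {u : R -> R}.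
Hypothesis uu : utility_function u.
Variables (alpha S0 : R) (S : T -> R).
Hypotheses (S0_gt0 : 0 < S0) (S_heart : heart_fun (P := P) (u := u) S).
Hypotheses (S_ge0 : forall w, 0 <= S w) (S_neq0 : ~ {ae P, forall w, S w = 0}).
Implicit Types f g : T -> R.

Local Notation phi := (orlicz_of_utility u).
Local Notation integrable f := (P.-integrable setT (EFin \o f)).
Local Notation heart := (heart_fun (P := P) (u := u)).

(** This is the function [f_X] of the overview, real-valued because its integrand is integrable for
    [f] in the heart. *)
Definition level f (m : R) : R := \int[P]_w u (f w + m / S0 * S w).

Lemma heart_position f m : heart f -> heart (fun w => f w + m / S0 * S w).
Proof. by move=> hf; apply: heartD => //; exact: heartM. Qed.

Lemma integrable_position f m : heart f ->
  integrable (fun w => u (f w + m / S0 * S w)).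
Proof. by move=> /(heart_position _ m)/(heart_integrable uu)[]. Qed.

Lemma level_homo f : heart f -> {homo level f : m n / m <= n}.
Proof.
move=> hf m n mn; apply: le_Rintegral; [by []|exact: integrable_position..|].
move=> w _; apply: utility_homo => //; rewrite lerD2l ler_wpM2r//.
by rewrite ler_wpM2r// invr_ge0 ltW.
Qed.

Lemma level_concave f (t m n : R) : heart f -> 0 <= t -> t <= 1 ->
  (1 - t) * level f m + t * level f n <= level f ((1 - t) * m + t * n).
Proof.
move=> hf t0 t1; have ipos k := integrable_position f k hf.
rewrite -!RintegralZl// -RintegralD//; [|exact: integrable_scale..].
apply: le_Rintegral => //.
  by apply: integrable_add; exact: integrable_scale.
move=> w _; apply: le_trans (utility_concave uu _ _ _ t0 t1) _.
by apply: utility_homo => //; lra.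
Qed.

Lemma Rintegral_S_gt0 : 0 < \int[P]_w S w.
Proof.
have [Si _] := heart_integrable uu _ S_heart.
rewrite lt_neqAle Rintegral_ge0// andbT eq_sym; apply/eqP => S0E; apply: S_neq0.
exact: Rintegral_eq0.
Qed.

(** The integrated affine bound of [u] is affine in [m] with slope [s * I / S0 > 0]; [m0] is where
    it equals [alpha]. *)
Lemma level_bounded_below f : heart f ->
  exists m0, forall m, alpha <= level f m -> m0 <= m.
Proof.
move=> hf; have [s [c [s0 uc]]] := utility_le_affine uu.
have [fi _] := heart_integrable uu _ hf.
have [Si _] := heart_integrable uu _ S_heart.
have IS := Rintegral_S_gt0; set I := \int[P]_w S w in IS.
pose J := c + s * \int[P]_w f w.
exists ((alpha - J) / (s * I) * S0) => m am.
rewrite -ler_pdivlMr// ler_pdivrMr ?mulr_gt0// lerBlDl.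
apply: le_trans am _.
have -> : J + m / S0 * (s * I) = \int[P]_w (c + s * (f w + m / S0 * S w)).
  rewrite RintegralD//; last 2 first.
  - exact: integrable_cst.
  - by apply: integrable_scale; apply: integrable_add => //; exact: integrable_scale.
  rewrite Rintegral_prob_cst RintegralZl//; last first.
    by apply: integrable_add => //; exact: integrable_scale.
  rewrite RintegralD//; last exact: integrable_scale.
  by rewrite RintegralZl// /J /I; lra.
apply: le_Rintegral => //; first exact: integrable_position.
apply: integrable_add; first exact: integrable_cst.
by apply: integrable_scale; apply: integrable_add => //; exact: integrable_scale.
Qed.

(* A concave function which exceeds [alpha] somewhere cannot stay at [alpha] on
   an interval. *)
Lemma level_gt f (m n p : R) : heart f -> alpha <= level f m -> m < n ->
  alpha < level f p -> alpha < level f n.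
Proof.
move=> hf am mn ap.
have [pn|np] := leP p n; first exact: lt_le_trans ap (level_homo _ hf _ _ pn).
have mp : 0 < p - m by lra.
pose t := (n - m) / (p - m).
have tE : t * (p - m) = n - m by rewrite divfK// gt_eqF.
have t0 : 0 < t by rewrite divr_gt0// subr_gt0.
have t1 : t <= 1 by rewrite ler_pdivrMr//; lra.
have := level_concave _ _ m p hf (ltW t0) t1.
have -> : (1 - t) * m + t * p = n by lra.
by nra.
Qed.

Lemma measurable_payoff_if (x : R) (f : T -> R) : measurable_fun setT f ->
  measurable_fun setT
    (fun w => if 0 < S w then u x else Num.min (u x) (u (f w))).
Proof.
move=> mf; apply: measurable_fun_ifT => //.
  by apply: measurable_fun_ltr => //; exact: heart_measurable S_heart.
by apply: measurable_minr => //; exact: (measurable_utility_comp uu).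
Qed.

(** The integrand [h] is the limit of [min (u x) (u (f + n * S))], and truncating at [u x] makes
    dominated convergence applicable. Were all levels at most [b], so would be the integral of
    [h]. *)
Lemma level_eventually_gt f (b x : R) : heart f ->
  b < \int[P]_w (if 0 < S w then u x else Num.min (u x) (u (f w))) ->
  exists m, b < level f m.
Proof.
move=> hf; set h := fun w => if _ then _ else _.
pose g (n : nat) w := Num.min (u x) (u (f w + n%:R * S w)).
move=> bh; apply: contrapT => nex.
have [_ ufi] := heart_integrable uu _ hf.
have mS := heart_measurable _ S_heart; have mf := heart_measurable _ hf.
have mg n : measurable_fun setT (g n).
  apply: measurable_minr => //; apply: (measurable_utility_comp uu).
  by apply: measurable_funD => //; exact: measurable_scale.
(* The amount [m = n * S0] buys [n] units of the payoff. *)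
have gn n : n%:R = n%:R * S0 / S0 :> R by rewrite mulfK// gt_eqF.
have gb n w : `|g n w| <= `|u x| + `|u (f w)|.
  have h1 : g n w <= u x by rewrite /g ge_min lexx.
  have h2 : Num.min (u x) (u (f w)) <= g n w.
    rewrite /g le_min ge_min lexx/= ge_min; apply/orP; right.
    apply: utility_homo => //; by rewrite lerDl mulr_ge0.
  have h3 : - (`|u x| + `|u (f w)|) <= Num.min (u x) (u (f w)).
    rewrite le_min; have := ler_norm (- u x); have := ler_norm (- u (f w)).
    have := normr_ge0 (u x); have := normr_ge0 (u (f w)).
    by rewrite !normrN => *; apply/andP; split; lra.
  by rewrite ler_norml; have := ler_norm (u x); have := normr_ge0 (u (f w));
    move=> *; apply/andP; split; lra.
have bi : integrable (fun w => `|u x| + `|u (f w)|).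
  apply: integrable_add; first exact: integrable_cst.
  exact: (integrable_norm ufi).
have gi n : integrable (g n) by apply: integrable_dominated bi.
have gle n : \int[P]_w g n w <= b.
  rewrite leNgt; apply/negP => bg; apply: nex; exists (n%:R * S0).
  apply: lt_le_trans bg _; rewrite /level -gn; apply: le_Rintegral => //.
    by rewrite [n%:R]gn; exact: integrable_position.
  by move=> w _; rewrite /g ge_min lexx orbT.
(* Pointwise the sequence is eventually constant: where [S w > 0], as soon as
   [n >= (x - f w) / S w]. *)
have gh w : \forall n \near \oo, g n w = h w.
  rewrite /h; have [Sw|Sw] := ltP 0 (S w); last first.
    have Sw0 : S w = 0 by apply/eqP; rewrite eq_le Sw S_ge0.
    by apply: nearW => n; rewrite /g Sw0 mulr0 addr0.
  near=> n; apply/min_idPl; apply: utility_homo => //.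
  rewrite -lerBlDl -ler_pdivrMr//; near: n; exact: nbhs_infty_ger.
have mh : measurable_fun setT h by exact: measurable_payoff_if.
have [||||hi _ gcvg] := @dominated_convergence _ _ _ P setT measurableT
    (fun n => EFin \o g n) (EFin \o h) _ _ _ _ bi _.
- by move=> n; exact/measurable_EFinP.
- exact/measurable_EFinP.
- apply: aeW => w _; apply: cvg_near_cst.
  by apply: filterS (gh w) => n /= ->.
- by apply: aeW => w n _ /=; rewrite lee_fin.
have intE k : integrable k -> (\int[P]_w (k w)%:E)%E = (\int[P]_w k w)%:E.
  by move=> ki; rewrite -EFin_Rintegral// unlock.
move: bh; rewrite ltNge => /negP; apply; rewrite -lee_fin -intE//.
apply: cvge_le gcvg; apply: nearW => n.
by rewrite [leLHS]intE// lee_fin.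
Unshelve. all: by end_near. Qed.

(** The shortfall risk for functions and the modified payoff; [shortfall_riskE] identifies it with
    [shortfall_risk]. *)
Definition shortfall f : \bar R :=
  ereal_inf [set m%:E | m in [set m | alpha <= level f m]].

Lemma shortfall_le f m : alpha <= level f m -> (shortfall f <= m%:E)%E.
Proof. by move=> am; apply: ereal_inf_lbound; exists m. Qed.

Lemma shortfall_ge f m : heart f -> level f m < alpha -> (m%:E <= shortfall f)%E.
Proof.
move=> hf ma; apply: le_ereal_inf_tmp => _ [n /= an <-]; rewrite lee_fin.
rewrite leNgt; apply/negP => nm.
by have := level_homo _ hf _ _ (ltW nm); lra.
Qed.

Lemma shortfall_fin_num f m : heart f -> alpha <= level f m ->
  shortfall f \is a fin_num.
Proof.
move=> hf am; have [m0 hm0] := level_bounded_below _ hf.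
have lb : (m0%:E <= shortfall f)%E.
  by apply: le_ereal_inf_tmp => _ [n /= an <-]; rewrite lee_fin hm0.
by rewrite fin_numE -ltNye -ltey (lt_le_trans (ltNyr _) lb)
  (le_lt_trans (shortfall_le _ _ am) (ltry _)).
Qed.

Lemma level_lt_of_shortfall f m : (m%:E < shortfall f)%E -> level f m < alpha.
Proof.
by rewrite !ltNge => /negP mf; apply/negP => am; exact/mf/shortfall_le.
Qed.

(** Some [n < m] is acceptable, and [level_gt] makes the inequality strict at [m]; only a strict
    inequality survives a perturbation of [f]. *)
Lemma level_gt_of_shortfall f m p : heart f -> (shortfall f < m%:E)%E ->
  alpha < level f p -> alpha < level f m.
Proof.
move=> hf /ereal_inf_lt[_ [n /= an <-]]; rewrite lte_fin => nm ap.
exact: level_gt an nm ap.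
Qed.

Lemma level_cvg f (m e : R) : heart f -> 0 < e ->
  exists2 r : R, 0 < r & forall g, heart g ->
    luxemburg_norm P phi (fun w => g w - f w) < r ->
    `|level g m - level f m| < e.
Proof.
move=> hf e0; have hfm := heart_position _ m hf.
set C := level f m - u 0 + \int[P]_w phi (2 * (f w + m / S0 * S w)) + 1.
have C0 : 0 < `|C| + 1 by rewrite ltr_wpDl.
(* The first bound gives [2 * l <= 1], the second [2 * l * (|C| + 1) < e]; the [+ 1] keeps the
   denominator positive. *)
exists (Num.min 2^-1 (e / (2 * (`|C| + 1)))).
  by rewrite lt_min invr_gt0 ltr0n divr_gt0// mulr_gt0.
move=> g hg; have hgf : heart (fun w => g w - f w).
  have := heartD uu _ _ hg (heartM uu (-1) _ hf).
  by under eq_fun do rewrite mulN1r.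
move=> /(luxemburg_norm_lt uu _ _ hgf)[l [l0]].
rewrite lt_min => /andP[l1 le gfl].
have := heart_perturb uu l _ _ hfm hgf l0 _ gfl.
have -> : \int[P]_w u (f w + m / S0 * S w + (g w - f w)) = level g m.
  by apply: eq_Rintegral => w _; congr u; ring.
rewrite -/(level f m) -/C => /(_ ltac:(lra)) gC.
apply: le_lt_trans gC _; apply: (@le_lt_trans _ _ (2 * l * (`|C| + 1))).
  apply: ler_wpM2l; first lra.
  by rewrite (le_trans (ler_norm C))// lerDl.
by move: le; rewrite ltr_pdivlMr ?mulr_gt0//; lra.
Qed.

(** With [r] the risk of [f], the level is strictly below [alpha] at [r - e] and strictly above it
    at [r + e]. By [level_cvg] at these two points both persist for nearby [g], which brackets the
    risk of [g]. *)
Lemma shortfall_cvg f (e : R) : heart f -> 0 < e ->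
  (exists p, alpha < level f p) ->
  exists2 r : R, 0 < r & forall g, heart g ->
    luxemburg_norm P phi (fun w => g w - f w) < r ->
    (shortfall f - e%:E <= shortfall g <= shortfall f + e%:E)%E.
Proof.
move=> hf e0 [p ap].
have := shortfall_fin_num _ _ hf (ltW ap); case E : (shortfall f) => [r| |]// _.
have lo : level f (r - e) < alpha.
  by apply: level_lt_of_shortfall; rewrite E lte_fin; lra.
have hi : alpha < level f (r + e).
  by apply: level_gt_of_shortfall ap => //; rewrite E lte_fin; lra.
have [r1 r10 hr1] := level_cvg _ (r - e) (alpha - level f (r - e)) hf ltac:(lra).
have [r2 r20 hr2] := level_cvg _ (r + e) (level f (r + e) - alpha) hf ltac:(lra).
exists (Num.min r1 r2) => [|g hg]; first by rewrite lt_min r10.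
rewrite lt_min => /andP[/(hr1 _ hg) g1 /(hr2 _ hg) g2].
rewrite -EFinB -EFinD; apply/andP; split.
- by apply: shortfall_ge => //; move: g1; rewrite ltr_norml => /andP[_]; lra.
- by apply: shortfall_le; move: g2; rewrite ltr_norml => /andP[]; lra.
Qed.

End level.

(** * Unbounded variables on nonatomic spaces *)

Section nonatomic.
Context {d : measure_display} {T : measurableType d} {R : realType}.
Context {P : probability T R}.
Hypothesis natomP : nonatomic P.

(** A splitting of [A] into two parts of positive probability has a part carrying at most half the
    mass. *)
Lemma nonatomic_half (A : set T) : measurable A -> (0 < P A)%E ->
  exists B, [/\ measurable B, B `<=` A, (0 < P B)%E &
    (P B <= (2^-1 * fine (P A))%:E)%E].
Proof.
move=> mA PA; have [B [mB BA PB BltA]] := natomP A mA PA.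
have EA := fineK (fin_num_measure P A mA); have EB := fineK (fin_num_measure P B mB).
have [h|h] := leP (fine (P B)) (2^-1 * fine (P A)).
  by exists B; split=> //; rewrite -EB lee_fin.
have mAB : measurable (A `\` B) by exact: measurableD.
have PAB : P (A `\` B) = (fine (P A) - fine (P B))%:E.
  rewrite measureD//; last by rewrite -EA ltry.
  by rewrite (setIidr BA) -{1}EA -{1}EB -EFinB.
exists (A `\` B); split=> //; rewrite PAB ?lte_fin ?lee_fin.
  by rewrite subr_gt0 -lte_fin EA EB.
by lra.
Qed.

Lemma nonatomic_small (A : set T) (e : R) : measurable A -> (0 < P A)%E -> 0 < e ->
  exists B, [/\ measurable B, B `<=` A, (0 < P B)%E, (P B < P A)%E &
    (P B <= e%:E)%E].
Proof.
move=> mA PA e0.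
have iter_half n : exists B, [/\ measurable B, B `<=` A, (0 < P B)%E &
    (P B <= ((2^-1) ^+ n * fine (P A))%:E)%E].
  elim: n => [|n [B [mB BA PB Bn]]].
    by exists A; split=> //; rewrite expr0 mul1r fineK// fin_num_measure.
  have [C [mC CB PC Cn]] := nonatomic_half _ mB PB.
  exists C; split=> //; first exact: subset_trans CB BA.
  apply: le_trans Cn _; rewrite lee_fin exprS -mulrA ler_wpM2l//.
  by rewrite -lee_fin fineK// fin_num_measure.
have pA : 0 < fine (P A) by rewrite -lte_fin fineK// fin_num_measure.
have pA1 : fine (P A) <= 1.
  by rewrite -lee_fin fineK ?fin_num_measure//; exact: probability_le1.
(* From [1 / e < n <= 2 ^ n]. *)
have [n en] : exists n, (2^-1) ^+ n <= e :> R.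
  exists (Num.bound e^-1); rewrite exprVn invf_ple ?posrE ?exprn_gt0//.
  apply: le_trans (ltW (archi_boundP _)) _; first by rewrite invr_ge0 ltW.
  by rewrite -natrX ler_nat ltnW// ltn_expl.
(* The extra halving makes [P B < P A] strict. *)
have [B [mB BA PB Bn]] := iter_half n.+1.
have Be : 2^-1 ^+ n.+1 * fine (P A) <= 2^-1 * Num.min e (fine (P A)).
  rewrite exprS -mulrA ler_wpM2l// le_min; apply/andP; split.
    by apply: le_trans en; rewrite ler_piMr// exprn_ge0// invr_ge0.
  apply: ler_piMl; first exact: ltW.
    by apply: exprn_ile1; lra.
have me : 0 < Num.min e (fine (P A)) by rewrite lt_min e0.
exists B; split=> //.
- apply: le_lt_trans Bn _; rewrite -[X in (_ < X)%E]fineK ?fin_num_measure// lte_fin.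
  apply: le_lt_trans Be _.
  have : Num.min e (fine (P A)) <= fine (P A) by rewrite ge_min lexx orbT.
  lra.
- apply: le_trans Bn _; rewrite lee_fin (le_trans Be)//.
  have : Num.min e (fine (P A)) <= e by rewrite ge_min lexx.
  lra.
Qed.

(* The level sets [N = n] are taken inside [A] with positive probability small
   enough to compensate for the growth of [c]. *)
Lemma nonatomic_unbounded (A : set T) (c : nat -> R) :
  measurable A -> (0 < P A)%E -> (forall n, 0 <= c n) -> c 0%N = 0 ->
  exists N : T -> nat,
    [/\ forall b : nat -> R, measurable_fun setT (b \o N),
        P.-integrable setT (EFin \o (c \o N)) &
        forall n, exists B, [/\ measurable B, B `<=` A, (0 < P B)%E &
          forall w, B w -> N w = n.+1]].
Proof.
move=> mA PA c0 c00.
(* Chosen so that [c n.+1 * e n <= 1 / 2 ^ n.+2], a summable bound; [1 + c n.+1] avoids a zero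
   denominator. *)
pose e n : R := 1 / (2 ^ n.+2)%:R / (1 + c n.+1).
have e0 n : 0 < e n by rewrite !divr_gt0// ltr_pwDl.
have [h hP] : {h : set T * nat -> set T & forall Bn : set T * nat,
    measurable Bn.1 -> (0 < P Bn.1)%E ->
    [/\ measurable (h Bn), h Bn `<=` Bn.1, (0 < P (h Bn))%E, (P (h Bn) < P Bn.1)%E &
    (P (h Bn) <= (e Bn.2)%:E)%E]}.
  apply: (@choice _ _ (fun Bn C => measurable Bn.1 -> (0 < P Bn.1)%E ->
    [/\ measurable C, C `<=` Bn.1, (0 < P C)%E, (P C < P Bn.1)%E &
    (P C <= (e Bn.2)%:E)%E])) => -[B n] /=.
  (* The choice function must be total, hence a dummy value on sets that do not qualify. *)
  have [[mB PB]|nB] := pselect (measurable B /\ (0 < P B)%E).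
    by have [C hC] := nonatomic_small _ _ mB PB (e0 n); exists C.
  by exists set0 => mB PB; case: nB.
pose C := fix C n := if n is k.+1 then h (C k, k) else A.
have C_prop n : [/\ measurable (C n), (0 < P (C n))%E & C n `<=` A].
  elim: n => [|n [mC PC CA]]; first by split.
  have [mh hC Ph _ _] := hP (C n, n) mC PC.
  by split=> //; exact: subset_trans hC CA.
have CS n : [/\ C n.+1 `<=` C n, (P (C n.+1) < P (C n))%E &
    (P (C n.+1) <= (e n)%:E)%E].
  by have [mC PC _] := C_prop n; have [] := hP (C n, n) mC PC.
have mC n : measurable (C n) by have [] := C_prop n.
have C_homo m n : (m <= n)%N -> C n `<=` C m.
  move=> /subnKC <-; elim: (n - m)%N => [|k ih]; first by rewrite addn0.
  by rewrite addnS; apply: subset_trans ih; have [] := CS (m + k)%N.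
(* The layers of the decreasing sequence [C] are disjoint, and of positive probability since each
   inclusion loses mass. *)
pose D n := C n `\` C n.+1.
have mD n : measurable (D n) by exact: measurableD.
have D_inj w m n : D m w -> D n w -> m = n.
  wlog mn : m n / (m <= n)%N.
    move=> H Dm Dn; have [mn|/ltnW nm] := leqP m n; first exact: H.
    by apply/esym/H.
  move=> [_ nCm] [Cn _]; apply/eqP; rewrite eqn_leq mn leqNgt; apply/negP => mn1.
  by apply: nCm; exact: C_homo Cn.
have PD n : (0 < P (D n))%E.
  have [CSn Pn _] := CS n; rewrite measureD//; last first.
    by rewrite -ge0_fin_numE ?fin_num_measure.
  by rewrite (setIidr CSn) sube_gt0.
(* Points in no layer, outside [A] or in every [C n], get the default [0]. So the fibre over [0] may
   exceed [D 0]; [c 0 = 0] removes its contribution. *)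
pose N w := xget 0%N [set n | D n w].
have NE n w : D n w -> N w = n.
  by move=> Dn; apply: xget_unique => // m Dm; exact: D_inj Dm Dn.
pose F n := N @^-1` [set n].
have FS n : F n.+1 = D n.+1.
  apply/seteqP; split=> w; last exact: NE.
  by rewrite /F /= /N; case: xgetP => // m _ Dm <-.
have mFS n : measurable (F n.+1) by rewrite FS.
have mF n : measurable (F n).
  case: n => // ; have -> : F 0%N = ~` \bigcup_n F n.+1.
    apply/seteqP; split=> w; first by rewrite /F /= => N0 [n _] /=; rewrite N0.
    move=> nF; rewrite /F /=; case E : (N w) => [//|n]; exfalso; apply: nF.
    by exists n.
  by apply: measurableC; exact: bigcup_measurable.
have mbN (b : nat -> R) : measurable_fun setT (b \o N).
  move=> _ Y mY; rewrite setTI.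
  have -> : (b \o N) @^-1` Y = \bigcup_(n in [set n | Y (b n)]) F n.
    apply/seteqP; split=> w; first by move=> Yw; exists (N w).
    by move=> [n /= Yn]; rewrite /F /= => ->.
  by apply: bigcup_measurable.
exists N; split=> //; last first.
  move=> n; exists (D n.+1); split=> //; last by move=> w; exact: NE.
  by move=> w [Cw _]; have [_ _] := C_prop n.+1; apply.
apply/integrableP; split; first exact/measurable_EFinP.
have FT : setT = \bigcup_n F n by apply/seteqP; split=> w // _; exists (N w).
rewrite (eq_integral (fun w => (c (N w))%:E)); last first.
  by move=> w _; rewrite gee0_abs// lee_fin; exact: c0.
rewrite FT ge0_integral_bigcup//.
- apply: (@le_lt_trans _ _ (\sum_(n <oo) (1 / (2 ^ n.+1)%:R)%:E)%E); last first.
    by apply: le_lt_trans (epsilon_trick0 _ ler01) (ltry _).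
  apply: lee_nneseries => [n _ _|n _].
    by apply: integral_ge0 => w _; rewrite lee_fin.
  have -> : (\int[P]_(w in F n) (c (N w))%:E = (c n)%:E * P (F n))%E.
    rewrite -integral_cst//; apply: eq_integral => w; rewrite inE /F /= => ->.
    by [].
  case: n => [|n]; first by rewrite c00 mul0e lee_fin.
  have [_ _ Pe] := CS n.
  have PFe : (P (F n.+1) <= (e n)%:E)%E.
    rewrite FS; apply: le_trans Pe; apply: le_measure; rewrite ?inE//.
    by move=> w [].
  apply: (le_trans (lee_wpmul2l _ PFe)); first by rewrite lee_fin.
  rewrite -EFinM lee_fin /e mulrCA ler_piMr ?divr_ge0//.
  by rewrite ler_pdivrMr ?ltr_pwDl// mul1r lerDr.
- by apply/measurable_EFinP; apply: measurable_funS (mbN c).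
- by move=> w _; rewrite lee_fin.
- exact: trivIset_preimage1.
Qed.

End nonatomic.

(** * The risk of elements of L0 *)

Section L0.
Context {d : measure_display} {T : measurableType d} {R : realType}.
Context {P : probability T R}.

Lemma measurable_L0 (X : {mfun_ P, T >-> R}) : measurable_fun setT (X : T -> R).
Proof. exact: measurable_funP. Qed.

(** Lets the counterexamples, built as functions, be used as positions in L0. *)
Lemma L0_class (f : T -> R) : measurable_fun setT f ->
  exists X : {mfun_ P, T >-> R}, {ae P, forall w, X w = f w}.
Proof.
move=> mf; pose F : {mfun T >-> R} := mfun_Sub (mem_set mf).
exists (\pi_({mfun_ P, T >-> R})%qT F).
have : ae_eq_op P (repr (\pi_({mfun_ P, T >-> R})%qT F)) F.
  by apply/eqmodP; rewrite reprK.
by move=> /asboolP; apply: filterS => w /(_ I).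
Qed.

Lemma ae_meet (A : set T) (Q : T -> Prop) : measurable A -> (0 < P A)%E ->
  {ae P, forall w, Q w} -> exists w, A w /\ Q w.
Proof.
move=> mA PA [N [mN N0 QN]]; apply: contrapT => nex.
suff : (P A <= P N)%E by rewrite N0 leNgt PA.
apply: le_measure; rewrite ?inE// => w Aw; apply: QN => /= Qw.
by apply: nex; exists w.
Qed.

Lemma measurable_fiber (f : T -> R) (r : R) : measurable_fun setT f ->
  measurable [set w | f w = r].
Proof.
by move=> mf; have := mf measurableT _ (measurable_set1 r); rewrite setTI.
Qed.

Lemma measurable_superlevel (f : T -> R) (r : R) : measurable_fun setT f ->
  measurable [set w | r < f w].
Proof.
move=> mf; have -> : [set w | r < f w] = setT `&` f @^-1` `]r, +oo[.
  by apply/seteqP; split=> w /=; rewrite in_itv/= andbT => // -[].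
by apply: mf => //; exact: measurable_itv.
Qed.

End L0.

(** * Finiteness and continuity of the shortfall risk on the Orlicz heart *)

Section main.
Context {d : measure_display} {T : measurableType d} {R : realType}.
Context {P : probability T R} {u : R -> R}.
Hypothesis uu : utility_function u.
Variables (alpha S0 : R) (ST : {mfun_ P, T >-> R}).
Hypothesis asset : traded_asset (orlicz_of_utility u) S0 ST.
Implicit Types X Y : {mfun_ P, T >-> R}.

Local Notation phi := (orlicz_of_utility u).
Local Notation heart := (heart_fun (P := P) (u := u)).
Local Notation rho := (shortfall_risk u alpha S0 ST).

(** As [phi >= 0], a finite expectation amounts to integrability. *)
Lemma orlicz_heartP X : orlicz_heart phi X <-> heart X.
Proof.
have mX l : measurable_fun setT (fun w => phi (l * X w)).
  apply: (measurable_orlicz_comp uu); apply: measurable_scale; exact: measurable_L0.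
split=> [hX|[_ hX] l /hX li].
  split=> [|l /hX li]; first exact: measurable_L0.
  apply/integrableP; split; first exact/measurable_EFinP.
  move: li; rewrite unlock; congr (_ < _)%E; apply: eq_integral => w _.
  by rewrite /= ger0_norm// (orlicz_ge0 uu).
by rewrite EFin_Rintegral// ltry.
Qed.

(* Replacing the payoff by its positive part makes it nonnegative everywhere. *)
Let S w := Num.max (ST w) 0.

Let S_ae : {ae P, forall w, ST w = S w}.
Proof. by case: asset => _ _ _; apply: filterS => w /= h; rewrite /S max_l. Qed.

Let S0_gt0 : 0 < S0. Proof. by case: asset. Qed.

Let S_heart : heart S.
Proof.
case: asset => _ /orlicz_heartP hS _ _; apply: ae_eq_heart hS _ S_ae => //.
by apply: measurable_maxr => //; exact: measurable_L0.
Qed.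

Let S_ge0 w : 0 <= S w. Proof. by rewrite /S le_max lexx orbT. Qed.

Let S_neq0 : ~ {ae P, forall w, S w = 0}.
Proof.
case: asset => _ _ nS _ Sw; apply: nS; have := S_ae.
by apply: filterS2 Sw => w /= -> ->.
Qed.

Local Notation level := (level (P := P) (u := u) S0 S).

Let mS : measurable_fun setT S. Proof. exact: heart_measurable S_heart. Qed.

Lemma expectation_level X m : heart X ->
  'E_P[fun w => u (X w + m / S0 * ST w)]%E = (level X m)%:E.
Proof.
move=> hX.
have i1 := integrable_position uu S0 _ S_heart _ m hX.
have mi : measurable_fun setT (fun w => u (X w + m / S0 * ST w)).
  apply: (measurable_utility_comp uu); apply: measurable_funD.
    exact: measurable_L0.
  by apply: measurable_scale; exact: measurable_L0.
have SST : {ae P, forall w, u (X w + m / S0 * S w) = u (X w + m / S0 * ST w)}.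
  by have := S_ae; apply: filterS => w /= ->.
rewrite EFin_Rintegral; last exact: (ae_eq_integrable _ _ i1 mi SST).
congr EFin; apply/esym/ae_eq_Rintegral => //.
exact: (integrable_measurable _ i1).
Qed.

Lemma shortfall_riskE X : heart X ->
  rho X = shortfall (P := P) (u := u) alpha S0 S X.
Proof.
move=> hX; rewrite /shortfall_risk /shortfall; congr (ereal_inf (image _ _)).
by apply/seteqP; split=> m /=; rewrite expectation_level// lee_fin.
Qed.

Lemma level_class X (f : T -> R) m : {ae P, forall w, X w = f w} ->
  measurable_fun setT f -> level X m = level f m.
Proof.
move=> Xf mf; apply: ae_eq_Rintegral.
- apply: (measurable_utility_comp uu); apply: measurable_funD.
    exact: measurable_L0.
  exact: measurable_scale.
- apply: (measurable_utility_comp uu); apply: measurable_funD => //.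
  exact: measurable_scale.
- by apply: filterS Xf => w /= ->.
Qed.

Lemma shortfall_risk_fin_cvg :
  (forall X, heart X -> exists m, alpha < level X m) ->
  finitely_valued phi rho /\ luxemburg_continuous phi rho.
Proof.
move=> H; have fin X : orlicz_heart phi X -> rho X \is a fin_num.
  move=> /orlicz_heartP hX; rewrite shortfall_riskE//; have [m am] := H _ hX.
  exact: (shortfall_fin_num uu _ _ _ S0_gt0 S_heart S_ge0 S_neq0 _ _ hX (ltW am)).
split=> // X oX; have hX := (orlicz_heartP X).1 oX.
have := fin _ oX; rewrite shortfall_riskE//.
set r := shortfall _ _ _ _; case E : r => [y| |]// _ V.
move=> /nbhs_EFin/nbhs_ballP[e /= e0 eV].
(* Halved because [shortfall_cvg] gives weak inequalities and the ball is open. *)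
have e20 : 0 < e / 2 by lra.
have [k k0 kX] := shortfall_cvg uu alpha _ _ S0_gt0 S_heart S_ge0 S_neq0 _ _ hX e20 (H _ hX).
exists k => //= Y [/= oY /kX].
have hY := (orlicz_heartP Y).1 oY.
move=> /(_ hY); rewrite -(shortfall_riskE _ hY) -/r E => /andP[].
have := fin _ oY; case: (rho Y) => [z| |]// _.
rewrite -EFinB -EFinD !lee_fin => z1 z2.
by apply: eV; rewrite /ball /= ltr_norml; apply/andP; split; lra.
Qed.

(** With [S > 0] almost surely, the limit integrand of [level_eventually_gt] is a.s. the constant
    [u x]. *)
Lemma level_gt_bounded (x : R) X : alpha < u x -> P [set w | ST w = 0] = 0%E ->
  heart X -> exists m, alpha < level X m.
Proof.
move=> ax PST hX; apply: (level_eventually_gt uu _ _ S0_gt0 S_heart S_ge0 _ _ x hX).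
rewrite (@ae_eq_Rintegral _ _ _ _ _ (fun=> u x)) ?Rintegral_prob_cst//.
  exact: (measurable_payoff_if uu _ S_heart) (heart_measurable _ hX).
have : {ae P, forall w, ST w <> 0}.
  exists [set w | ST w = 0]; split=> //; last by move=> w /= /contrapT.
  exact/measurable_fiber/measurable_L0.
move=> nS; have := S_ae; apply: filterS2 nS => w /= nS SS.
by rewrite lt_neqAle S_ge0 andbT eq_sym -SS; case: eqP nS.
Qed.

Lemma level_gt_unbounded X : ~ has_ubound (range u) ->
  heart X -> exists m, alpha < level X m.
Proof.
move=> nub hX; pose A := [set w | 0 < S w].
have mA : measurable A by exact: measurable_superlevel.
have PA : 0 < fine (P A).
  rewrite fine_gt0// -ge0_fin_numE// fin_num_measure// andbT lt_neqAle measure_ge0.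
  rewrite andbT eq_sym; apply/eqP => PA0; apply: S_neq0; exists A; split=> // w /= Sw.
  by rewrite /A /= lt_neqAle S_ge0 andbT eq_sym; apply/eqP.
have [_ ufi] := heart_integrable uu _ hX.
pose b := `|alpha| + \int[P]_w `|u (X w)|.
have b0 : 0 <= b by rewrite addr_ge0// Rintegral_ge0.
(* Large enough that [u x * P (A)] minus the integral of [|u (X)|] exceeds [alpha]. *)
have [x bx] : exists x, (b + 1) / fine (P A) < u x.
  apply: contrapT => nex; apply: nub; exists ((b + 1) / fine (P A)) => _ [x _ <-].
  by rewrite leNgt; apply/negP => ?; apply: nex; exists x.
have ux0 : 0 <= u x by apply: le_trans _ (ltW bx); apply: divr_ge0; [lra|exact: ltW].
apply: (level_eventually_gt uu _ _ S0_gt0 S_heart S_ge0 _ _ x hX).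
have ai : P.-integrable setT (EFin \o (\1_A : T -> R)) by exact: integrable_indic.
have ni : P.-integrable setT (EFin \o (fun w => `|u (X w)|)).
  exact: (integrable_norm ufi).
have mh := measurable_payoff_if uu _ S_heart x _ (heart_measurable _ hX).
(* This minorant lies below [u x] on [A] and, as [u x >= 0], below [min (u x) (u (X))] off [A]. *)
apply: (@lt_le_trans _ _ (\int[P]_w (u x * \1_A w + -1 * `|u (X w)|))).
  rewrite RintegralD//; [|exact: integrable_scale..].
  rewrite !RintegralZl//.
  have -> : \int[P]_w (\1_A w : R) = fine (P A).
    by rewrite /Rintegral integral_indic// setIT.
  move: bx; rewrite ltr_pdivrMr// /b; have := ler_norm alpha; lra.
apply: le_Rintegral => //.
- by apply: integrable_add; exact: integrable_scale.
- apply: (integrable_dominated _ (fun w => u x + `|u (X w)|)) => //; last first.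
    by apply: integrable_add => //; exact: integrable_cst.
  move=> w; case: ifP => _; first by rewrite ger0_norm// lerDl.
  rewrite ler_norml ge_min lerDl normr_ge0/= andbT le_min.
  have := ler_norm (- u (X w)); have := normr_ge0 (u (X w)).
  by rewrite normrN => *; apply/andP; split; lra.
- move=> w _; rewrite indicE; have := normr_ge0 (u (X w)).
  have := ler_norm (- u (X w)); rewrite normrN => uN u0.
  have [Sw|Sw] := ltP 0 (S w).
    by rewrite mem_set//=; lra.
  by rewrite memNset /A /= ?ltNge ?Sw//= le_min; apply/andP; split; lra.
Qed.

Lemma asset_pos_of_fin : has_ubound (range u) -> finitely_valued phi rho ->
  P [set w | ST w = 0] = 0%E.
Proof.
move=> [B uB] fin; set A := [set w | _].
have mA : measurable A by exact/measurable_fiber/measurable_L0.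
apply: contrapT => PA0.
have PA : 0 < fine (P A).
  rewrite fine_gt0// -ge0_fin_numE// fin_num_measure// andbT lt_neqAle measure_ge0.
  by rewrite andbT eq_sym; apply/eqP.
have [s [c [s0 uc]]] := utility_le_affine uu.
(* The affine bound of [u] at [x] equals [(alpha - |B| - 1) / P (A)]. As the utility is at most
   [|B|] off [A], every level of the constant [x] is then at most [alpha - 1]. *)
pose x := ((alpha - `|B| - 1) / fine (P A) - c) / s.
have ux : u x * fine (P A) <= alpha - `|B| - 1.
  rewrite -ler_pdivlMr//; apply: le_trans (uc _) _.
  by rewrite /x mulrC divfK ?gt_eqF//; lra.
have mx : measurable_fun setT (fun _ : T => x) by [].
have [X Xx] := L0_class _ mx (P := P).
have hx : heart (fun=> x) by exact: heart_cst.
have hX : heart X.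
  apply: (ae_eq_heart uu _ _ hx (measurable_L0 X)).
  by apply: filterS Xx => w /= ->.
have := fin _ ((orlicz_heartP X).2 hX); rewrite shortfall_riskE// /shortfall.
suff -> : [set m | alpha <= level X m] = set0 by rewrite image_set0 ereal_inf0.
apply/seteqP; split=> // m /=; rewrite (level_class _ _ _ Xx mx) leNgt => /negP; apply.
have S_aeA : {ae P, forall w, \1_A w = \1_[set w | S w = 0] w :> R}.
  apply: filterS S_ae => w /= SS; rewrite !indicE; congr (_%:R); congr nat_of_bool.
  by apply/idP/idP; rewrite !inE /A /= SS.
have mA' : measurable [set w | S w = 0] by exact: measurable_fiber.
apply: (@le_lt_trans _ _ (\int[P]_w (u x * \1_[set w | S w = 0] w + `|B|))).
  apply: le_Rintegral => //.
  - exact: integrable_position.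
  - apply: integrable_add; last exact: integrable_cst.
    by apply: integrable_scale; exact: integrable_indic.
  - move=> w _; rewrite indicE; have [Sw|Sw] := pselect (S w = 0).
      by rewrite mem_set//= Sw mulr0 addr0 mulr1 lerDl.
    rewrite memNset//= mulr0 add0r (le_trans _ (ler_norm B))//.
    by apply: uB; eexists.
rewrite RintegralD//; [|by apply: integrable_scale; exact: integrable_indic|
  exact: integrable_cst].
rewrite RintegralZl//; last exact: integrable_indic.
have -> : \int[P]_w (\1_[set w | S w = 0] w : R) = fine (P A).
  rewrite -(ae_eq_Rintegral _ _ _ _ S_aeA) //.
  by rewrite /Rintegral integral_indic// setIT.
by rewrite Rintegral_prob_cst; lra.
Qed.

Lemma utility_gt_of_fin : nonatomic P -> finitely_valued phi rho ->
  exists x0, 0 < x0 /\ alpha < u x0.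
Proof.
move=> natomP fin; apply: contrapT => nex.
have ua x : u x <= alpha.
  (* Raising the point to at least [1] makes it positive without lowering the utility. *)
  rewrite leNgt; apply/negP => ax; apply: nex; exists (Num.max x 1).
  rewrite lt_max ltr01 orbT; split=> //; apply: lt_le_trans ax _.
  by apply: utility_homo => //; rewrite le_max lexx.
pose A (n : nat) := [set w | S w <= n%:R].
have mA n : measurable (A n).
  have -> : A n = ~` [set w | n%:R < S w].
    by apply/seteqP; split=> w /=; rewrite /A /= leNgt => /negP.
  exact/measurableC/measurable_superlevel.
(* The sets where [S <= n] exhaust the space, so they are not all null. *)
have [M PAM] : exists M, (0 < P (A M))%E.
  apply: contrapT => nP.
  have : P.-negligible (\bigcup_n A n).
    apply: negligible_bigcup => n; apply/negligibleP => //.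
    apply/eqP; rewrite eq_le measure_ge0 andbT leNgt; apply/negP => An.
    by apply: nP; exists n.
  have -> : \bigcup_n A n = setT.
    apply/seteqP; split=> // w _; exists (Num.bound (S w)) => //.
    by rewrite /A /= ltW// archi_boundP.
  move=> /(negligibleP P measurableT) /(etrans (esym (probability_setT P))).
  by move/eqP; rewrite onee_eq0.
(* As either [l <= N] or [N < l], [phi (l * N) <= phi (l * l) + phi (N * N)]; integrability of
   [c (N)] thus puts [N] in the heart. *)
pose c (n : nat) : R := phi (n%:R * n%:R).
have c0 n : 0 <= c n by exact: orlicz_ge0.
have c00 : c 0%N = 0.
  by rewrite /c /orlicz_of_utility mulr0 normr0 oppr0 subrr.
have [N [mN Ni NA]] := nonatomic_unbounded natomP _ c (mA M) PAM c0 c00.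
pose f w : R := - (N w)%:R.
have mf : measurable_fun setT f := mN (fun n => - n%:R).
have hf : heart f.
  split=> // l l0.
  apply: (integrable_dominated _ (fun w => phi (l * l) + c (N w))).
  - exact/(measurable_orlicz_comp uu)/measurable_scale.
  - move=> w; rewrite ger0_norm ?(orlicz_ge0 uu)//.
    have N0 : (0 : R) <= (N w)%:R by [].
    have [lN|Nl] := leP l (N w)%:R.
      apply: le_trans (ler_wpDl (orlicz_ge0 uu _) (lexx _)).
      apply: (orlicz_homo uu); rewrite !normrM /f normrN.
      by rewrite ler_wpM2r// (gtr0_norm l0) ger0_norm.
    apply: le_trans (ler_wpDr (c0 _) (lexx _)).
    apply: (orlicz_homo uu); rewrite !normrM /f normrN.
    by rewrite ler_wpM2l// (gtr0_norm l0) ger0_norm// ltW.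
  - by apply: integrable_add => //; exact: integrable_cst.
have [X Xf] := L0_class _ mf (P := P).
have hX : heart X.
  apply: (ae_eq_heart uu _ _ hf (measurable_L0 X)).
  by apply: filterS Xf => w /= ->.
have := fin _ ((orlicz_heartP X).2 hX); rewrite shortfall_riskE// /shortfall.
suff -> : [set m | alpha <= level X m] = set0 by rewrite image_set0 ereal_inf0.
apply/seteqP; split=> // m /=; rewrite (level_class _ _ _ Xf mf) => am.
(* An acceptable [m] forces the nonnegative [v] to have integral [0], hence to vanish almost
   surely. *)
set k := m / S0; pose v w := alpha + -1 * u (f w + k * S w).
have v0 w : 0 <= v w by rewrite /v mulN1r subr_ge0.
have vi : P.-integrable setT (EFin \o v).
  apply: integrable_add; first exact: integrable_cst.
  by apply: integrable_scale; exact: integrable_position.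
have Iv : \int[P]_w v w = 0.
  apply/eqP; rewrite eq_le Rintegral_ge0// andbT /v RintegralD//; last 2 first.
  - exact: integrable_cst.
  - by apply: integrable_scale; exact: integrable_position.
  rewrite Rintegral_prob_cst RintegralZl//; last exact: integrable_position.
  by move: am; rewrite /level -/k; lra.
have v_ae := Rintegral_eq0 _ vi v0 Iv.
have [s [a [s0 ua']]] := utility_le_affine uu.
(* On the layer [N = n.+1], where [S <= M], the position falls below [- |a - alpha| / s], so the
   affine bound gives utility below [alpha] there, although [v] vanishes at some point of it. *)
pose n := Num.bound (`|k| * M%:R + (`|a - alpha|) / s).
have [B [mB BA PB BN]] := NA n.
have [w [Bw vw]] := ae_meet _ _ mB PB v_ae.
have Sw : S w <= M%:R by exact: BA.
have kS : k * S w <= `|k| * M%:R.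
  apply: le_trans (ler_norm _) _; rewrite normrM ler_wpM2l//.
  by rewrite ger0_norm.
have nb : `|k| * M%:R + `|a - alpha| / s < n%:R.
  by apply: archi_boundP; rewrite addr_ge0 ?mulr_ge0// ?invr_ge0 ltW.
have : u (f w + k * S w) < alpha.
  apply: le_lt_trans (ua' _) _.
  have fw : f w + k * S w < - (`|a - alpha| / s).
    by rewrite /f BN// -natr1; lra.
  have : s * (f w + k * S w) < - `|a - alpha|.
    apply: (@lt_le_trans _ _ (s * - (`|a - alpha| / s))); first by rewrite ltr_pM2l.
    by rewrite mulrN mulrC divfK ?gt_eqF.
  have := ler_norm (a - alpha); lra.
by move: vw; rewrite /v; lra.
Qed.

End main.

Theorem proposition4p6 (d : measure_display) (T : measurableType d)
    (R : realType) (P : probability T R) (u : R -> R) (alpha S0 : R)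
    (ST : {mfun_ P, T >-> R}) :
  nonatomic P -> utility_function u -> (exists x : R, alpha <= u x) ->
  traded_asset (orlicz_of_utility u) S0 ST ->
  let phi := orlicz_of_utility u in
  let rho := shortfall_risk u alpha S0 ST in
  (has_ubound (range u) ->
    let b := (exists x0 : R, 0 < x0 /\ alpha < u x0) /\
             P [set w | ST w = 0] = 0%E in
    (finitely_valued phi rho <-> b) /\
    (finitely_valued phi rho -> luxemburg_continuous phi rho)) /\
  (~ has_ubound (range u) ->
    finitely_valued phi rho /\ luxemburg_continuous phi rho).
Proof.
move=> natomP uu _ asset phi rho; split=> [ubu b|nubu]; last first.
  apply: (shortfall_risk_fin_cvg uu _ _ _ asset) => X.
  exact: (level_gt_unbounded uu _ _ _ asset).
have fin_b : finitely_valued phi rho -> b.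
  move=> fin; split; first exact: (utility_gt_of_fin uu _ _ _ asset natomP fin).
  exact: (asset_pos_of_fin uu _ _ _ asset ubu fin).
(* Continuity is obtained together with finiteness, so that finiteness implies continuity by way of
   [b]. *)
have b_fin : b -> finitely_valued phi rho /\ luxemburg_continuous phi rho.
  move=> [[x [_ ax]] PST]; apply: (shortfall_risk_fin_cvg uu _ _ _ asset) => X.
  exact: (level_gt_bounded uu _ _ _ asset _ _ ax PST).
by split=> [|/fin_b/b_fin[]//]; split=> [/fin_b|/b_fin[]].
Qed.
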